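(* Let $\alpha,\beta,\eta,\gamma\ge0$ be real with $(\eta,\gamma)\neq(0,0)$, and let $\rho_1>0$ be fixed. For $\rho_2>0$ let $r^*=r^*(\rho_2)\ge0$ be the unique solution of $$R_{\mathrm w}\left(\alpha,\beta,\rho_1(1-2^{-r^*})\right)=R_{\mathrm w}(\eta,\gamma,\rho_2)-r^*,$$ let $R_{\mathrm{cf}}(\rho_2)=R_{\mathrm w}\left(\alpha,\beta,\rho_1(1-2^{-r^*(\rho_2)})\right)$, and let $$R_{\mathrm{ub}}(\rho_2)=\min\left\{R_{\mathrm w}(\alpha,\beta,\rho_1),\,R^{\mathrm{wf}}_{\mathrm w}(\eta,\gamma,\rho_2)\right\}.$$ Then, as $\rho_2\to\infty$, $r^*(\rho_2)\to\infty$ and $R_{\mathrm{cf}}(\rho_2)$ approaches the upper bound: $$\lim_{\rho_2\to\infty}R_{\mathrm{cf}}(\rho_2)=\lim_{\rho_2\to\infty}R_{\mathrm{ub}}(\rho_2)=R_{\mathrm w}(\alpha,\beta,\rho_1).$$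
   Context: For $a,b,\rho\ge0$ put $H(f)=b+2a\cos 2\pi f$ and $$R_{\mathrm w}(a,b,\rho)=\int_0^1\log_2\left(1+\rho H(f)^2\right)df .$$ For $(a,b)\ne(0,0)$ and $\rho>0$ put $$R^{\mathrm{wf}}_{\mathrm w}(a,b,\rho)=\int_0^1\log_2\left(1+\left(\nu-\frac1{H(f)^2}\right)^+H(f)^2\right)df,$$ where $(x)^+=\max\{x,0\}$ and $\nu>0$ is determined by $\int_0^1\left(\nu-\frac{1}{H(f)^2}\right)^+df=\rho$; the integrands are taken to be $0$ at points where $H(f)=0$. Interpretation: in a two-hop cellular uplink with infinitely many cells, $\rho_1$ and $\rho_2$ are the signal-to-noise ratios of the mobile-to-relay and relay-to-base-station hops, $R_{\mathrm{cf}}$ is the per-cell sum-rate of a compress-and-forward scheme, and $R_{\mathrm{ub}}$ is a cut-set-like upper bound. *)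

(* Defs.v *)
From Stdlib Require Import Reals ClassicalEpsilon.
From Coquelicot Require Import Coquelicot.
Open Scope R_scope.

(* For a, b, rho >= 0 all integrands below are continuous in f (the positive
   part in [wf_power] vanishes near the zeros of [transfer]), so Coquelicot's
   total Riemann integral [RInt] takes its genuine value. *)

Definition log2 (x : R) : R := ln x / ln 2.

Definition transfer (a b f : R) : R := b + 2 * a * cos (2 * PI * f).

Definition Rw (a b rho : R) : R :=
  RInt (fun f => log2 (1 + rho * transfer a b f ^ 2)) 0 1.

(* (nu - 1 / H(f)^2)^+, taken to be 0 where H(f) = 0. *)
Definition wf_power (a b nu f : R) : R :=
  if Req_EM_T (transfer a b f) 0 then 0
  else Rmax (nu - 1 / transfer a b f ^ 2) 0.

Definition is_water_level (a b rho nu : R) : Prop :=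
  0 < nu /\ RInt (wf_power a b nu) 0 1 = rho.

(* [epsilon] selects the unique water level when (a, b) <> (0, 0) and
   0 < rho, and an arbitrary real otherwise. *)
Definition water_level (a b rho : R) : R :=
  epsilon (inhabits 0) (is_water_level a b rho).

(* Where H(f) = 0 the integrand is log2 1 = 0. *)
Definition Rwf (a b rho : R) : R :=
  RInt (fun f => log2 (1 + wf_power a b (water_level a b rho) f
                           * transfer a b f ^ 2)) 0 1.

Definition is_rstar (alpha beta eta gamma rho1 rho2 r : R) : Prop :=
  0 <= r /\
  Rw alpha beta (rho1 * (1 - Rpower 2 (- r))) = Rw eta gamma rho2 - r.

(* Meaningful when exactly one real satisfies [is_rstar]. *)
Definition rstar (alpha beta eta gamma rho1 rho2 : R) : R :=
  epsilon (inhabits 0) (is_rstar alpha beta eta gamma rho1 rho2).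

Definition Rcf (alpha beta eta gamma rho1 rho2 : R) : R :=
  Rw alpha beta
     (rho1 * (1 - Rpower 2 (- rstar alpha beta eta gamma rho1 rho2))).

Definition Rub (alpha beta eta gamma rho1 rho2 : R) : R :=
  Rmin (Rw alpha beta rho1) (Rwf eta gamma rho2).

(* Main.v *)
Require Import Defs.
From Stdlib Require Import Reals Lra ClassicalEpsilon.
From Coquelicot Require Import Coquelicot.
Open Scope R_scope.

(* Both integrals are controlled by pointwise bounds on their integrands.  The
   power [W nu] spent at water level [nu] is 1-Lipschitz with [W 0 = 0], so the
   intermediate value theorem yields a level, and [W nu' >= (nu' / nu) * W nu]
   for [nu <= nu'] makes it unique; [W nu <= nu] shows that the level of [rho]
   is at least [rho].  Likewise [Rw] is nondecreasing and Lipschitz in [rho],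
   so [r + Rw (rho1 * (1 - 2^-r))] is continuous, strictly increasing and at
   least [r], which gives a unique [r*].  Since [H >= a + b] on [0, 1/6], both
   [Rw] and [Rwf] of the second hop are unbounded in [rho2]; the first forces
   [r*] to infinity, the second makes the minimum in [Rub] equal to its first
   argument eventually. *)

(** * Comparison of integrals over [0, 1], and continuity of Lipschitz functions *)

Lemma ex_RInt_01 (h : R -> R) : (forall x, continuous h x) -> ex_RInt h 0 1.
Proof. intros H; apply (ex_RInt_continuous (V := R_CompleteNormedModule)); auto. Qed.

Lemma RInt_01_le_add (h k : R -> R) (C : R) :
  (forall x, continuous h x) -> (forall x, continuous k x) ->
  (forall x, h x <= k x + C) -> RInt h 0 1 <= RInt k 0 1 + C.
Proof.
  intros Hh Hk H.
  assert (E : RInt (fun x => k x + C) 0 1 = RInt k 0 1 + C).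
  { rewrite (RInt_plus (V := R_CompleteNormedModule) k (fun _ => C)).
    - rewrite RInt_const. unfold plus, scal; simpl; unfold mult; simpl; ring.
    - now apply ex_RInt_01.
    - apply ex_RInt_const. }
  rewrite <- E. apply RInt_le.
  - lra.
  - now apply ex_RInt_01.
  - apply ex_RInt_01. intros x. apply (continuous_plus (V := R_NormedModule)); auto.
    apply continuous_const.
  - auto.
Qed.

Lemma RInt_01_le_scal (h k : R -> R) (C : R) :
  (forall x, continuous h x) -> (forall x, continuous k x) ->
  (forall x, C * h x <= k x) -> C * RInt h 0 1 <= RInt k 0 1.
Proof.
  intros Hh Hk H.
  assert (E : RInt (fun x => C * h x) 0 1 = C * RInt h 0 1).
  { apply (RInt_scal (V := R_CompleteNormedModule) h). now apply ex_RInt_01. }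
  rewrite <- E. apply RInt_le.
  - lra.
  - apply ex_RInt_01. intros x. apply (continuous_scal_r (V := R_NormedModule)); auto.
  - now apply ex_RInt_01.
  - auto.
Qed.

Lemma RInt_01_ge_0 (h : R -> R) :
  (forall x, continuous h x) -> (forall x, 0 <= h x) -> 0 <= RInt h 0 1.
Proof.
  intros Hh H. apply RInt_ge_0.
  - lra.
  - now apply ex_RInt_01.
  - auto.
Qed.

(** The part over [1/6, 1] is dropped by nonnegativity. The point 1/6 is where [2 * PI * f] reaches
    [PI / 3], up to which the cosine is at least 1/2. *)
Lemma RInt_01_ge_sixth (h : R -> R) (K : R) :
  (forall x, continuous h x) -> (forall x, 0 <= h x) ->
  (forall x, 0 <= x <= 1 / 6 -> K <= h x) -> K / 6 <= RInt h 0 1.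
Proof.
  intros Hc H0 HK.
  assert (Hex : forall u v, ex_RInt h u v).
  { intros u v. apply (ex_RInt_continuous (V := R_CompleteNormedModule)); auto. }
  assert (E := RInt_Chasles (V := R_CompleteNormedModule) h 0 (1 / 6) 1
                 (Hex _ _) (Hex _ _)).
  assert (B : 0 <= RInt h (1 / 6) 1).
  { apply RInt_ge_0; [lra | apply Hex | auto]. }
  assert (A : RInt (fun _ => K) 0 (1 / 6) <= RInt h 0 (1 / 6)).
  { apply RInt_le; [lra | apply ex_RInt_const | apply Hex |].
    intros x Hx. apply HK. lra. }
  rewrite RInt_const in A.
  unfold plus, scal in *; simpl in *; unfold mult in *; simpl in *. lra.
Qed.

Lemma lipschitz_continuity (F : R -> R) (L : R) :
  0 <= L -> (forall x y, x <= y -> Rabs (F y - F x) <= L * (y - x)) ->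
  continuity F.
Proof.
  intros HL H x eps Heps.
  (* Dividing by [L + 1] rather than [L] covers [L = 0]. *)
  exists (eps / (L + 1)). split.
  - apply Rdiv_lt_0_compat; lra.
  - intros y [_ Hy]. simpl in *. unfold R_dist in *.
    assert (Hb : Rabs (F y - F x) <= L * Rabs (y - x)).
    { destruct (Rle_dec x y) as [h | h].
      - rewrite (Rabs_pos_eq (y - x)) by lra. now apply H.
      - rewrite (Rabs_minus_sym (F y)), (Rabs_minus_sym y), (Rabs_pos_eq (x - y)) by lra.
        apply H. lra. }
    apply (Rmult_lt_compat_l (L + 1)) in Hy; [| lra].
    replace ((L + 1) * (eps / (L + 1))) with eps in Hy by (field; lra).
    assert (0 <= Rabs (y - x)) by apply Rabs_pos. lra.
Qed.

(** * The binary logarithm *)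

Lemma ln2_pos : 0 < ln 2.
Proof. rewrite <- ln_1. apply ln_increasing; lra. Qed.

Lemma log2_le (x y : R) : 0 < x -> x <= y -> log2 x <= log2 y.
Proof.
  intros Hx Hxy. unfold log2, Rdiv. apply Rmult_le_compat_r.
  - left. apply Rinv_0_lt_compat, ln2_pos.
  - now apply ln_le.
Qed.

Lemma log2_nonneg (x : R) : 1 <= x -> 0 <= log2 x.
Proof.
  intros Hx. replace 0 with (log2 1).
  - apply log2_le; lra.
  - unfold log2. rewrite ln_1. unfold Rdiv. ring.
Qed.

(** From [1 + u <= exp u] at [u = ln (y / x)]: [ln (y / x) <= (y - x) / x], and [1 <= x] removes the
    denominator. *)
Lemma log2_sub_le (x y : R) : 1 <= x -> x <= y -> log2 y - log2 x <= (y - x) / ln 2.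
Proof.
  intros Hx Hxy.
  assert (H2 := ln2_pos).
  assert (Hl : ln y - ln x <= y - x).
  { rewrite <- ln_div by lra.
    assert (Hy : 0 < y / x) by (apply Rdiv_lt_0_compat; lra).
    assert (He := exp_ineq1_le (ln (y / x))).
    rewrite exp_ln in He by exact Hy.
    assert (y / x - 1 <= y - x).
    { replace (y / x - 1) with ((y - x) / x) by (field; lra).
      apply Rle_div_l; [lra |]. nra. }
    lra. }
  unfold log2. replace (ln y / ln 2 - ln x / ln 2) with ((ln y - ln x) / ln 2)
    by (field; lra).
  apply Rmult_le_compat_r; [| exact Hl].
  left. now apply Rinv_0_lt_compat.
Qed.

Lemma log2_Rpower (x : R) : log2 (Rpower 2 x) = x.
Proof. unfold log2. rewrite ln_Rpower. field. assert (H := ln2_pos). lra. Qed.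

Lemma continuous_log2 (x : R) : 0 < x -> continuous log2 x.
Proof.
  intros Hx. apply (ex_derive_continuous (V := R_NormedModule)).
  unfold log2. auto_derive. exact Hx.
Qed.

(** * The squared transfer function *)

Lemma continuous_transfer_sqr (a b f : R) : continuous (fun x => transfer a b x ^ 2) f.
Proof.
  apply (ex_derive_continuous (V := R_NormedModule)).
  unfold transfer. auto_derive. exact I.
Qed.

Lemma transfer_sqr_le (a b f : R) :
  0 <= a -> 0 <= b -> transfer a b f ^ 2 <= (b + 2 * a) ^ 2.
Proof.
  intros Ha Hb. unfold transfer. assert (Hc := COS_bound (2 * PI * f)).
  assert (- (b + 2 * a) <= b + 2 * a * cos (2 * PI * f) <= b + 2 * a) by nra. nra.
Qed.

Lemma transfer_sqr_ge (a b f : R) :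
  0 <= a -> 0 <= b -> 0 <= f <= 1 / 6 -> (a + b) ^ 2 <= transfer a b f ^ 2.
Proof.
  intros Ha Hb Hf. unfold transfer.
  assert (Hp := PI_RGT_0).
  assert (Hc : 1 / 2 <= cos (2 * PI * f)).
  { rewrite <- cos_PI3. apply cos_decr_1; nra. }
  assert (a + b <= b + 2 * a * cos (2 * PI * f)) by nra. nra.
Qed.

(** * The rate [Rw] under constant power *)

(** Serves both rates: [p] is the constant [rho] for [Rw] and the water-filling power for [Rwf]. *)
Lemma continuous_rate (p t : R -> R) (f : R) :
  (forall x, 0 <= p x * t x) -> continuous p f -> continuous t f ->
  continuous (fun x => log2 (1 + p x * t x)) f.
Proof.
  intros Hpos Hp Ht.
  apply (continuous_comp (fun x => 1 + p x * t x) log2).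
  - apply (continuous_plus (V := R_NormedModule)); [apply continuous_const |].
    now apply (continuous_mult (K := R_AbsRing)).
  - apply continuous_log2. specialize (Hpos f). lra.
Qed.

Lemma continuous_Rw_integrand (a b rho f : R) : 0 <= rho ->
  continuous (fun x => log2 (1 + rho * transfer a b x ^ 2)) f.
Proof.
  intros Hr. apply (continuous_rate (fun _ => rho) (fun x => transfer a b x ^ 2)).
  - intros x. apply Rmult_le_pos; [exact Hr | apply pow2_ge_0].
  - apply continuous_const.
  - apply continuous_transfer_sqr.
Qed.

Lemma Rw_nonneg (a b rho : R) : 0 <= rho -> 0 <= Rw a b rho.
Proof.
  intros Hr. apply RInt_01_ge_0.
  - intros x. now apply continuous_Rw_integrand.
  - intros x. apply log2_nonneg. assert (H := pow2_ge_0 (transfer a b x)). nra.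
Qed.

Lemma Rw_le (a b rho rho' : R) : 0 <= rho -> rho <= rho' -> Rw a b rho <= Rw a b rho'.
Proof.
  intros Hr Hrr. rewrite <- (Rplus_0_r (Rw a b rho')). apply RInt_01_le_add.
  - intros x. now apply continuous_Rw_integrand.
  - intros x. apply continuous_Rw_integrand. lra.
  - intros x. rewrite Rplus_0_r. assert (H := pow2_ge_0 (transfer a b x)).
    apply log2_le; nra.
Qed.

(** Pointwise, the logarithm is [1 / ln 2]-Lipschitz on [1, oo) and its argument has slope
    [H^2 <= (b + 2 * a)^2] in [rho]. *)
Lemma Rw_lipschitz (a b rho rho' : R) : 0 <= a -> 0 <= b -> 0 <= rho -> rho <= rho' ->
  Rw a b rho' <= Rw a b rho + (b + 2 * a) ^ 2 / ln 2 * (rho' - rho).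
Proof.
  intros Ha Hb Hr Hrr. apply RInt_01_le_add.
  - intros x. apply continuous_Rw_integrand. lra.
  - intros x. now apply continuous_Rw_integrand.
  - intros x. assert (H := pow2_ge_0 (transfer a b x)).
    assert (H' := transfer_sqr_le a b x Ha Hb).
    assert (D := log2_sub_le (1 + rho * transfer a b x ^ 2) (1 + rho' * transfer a b x ^ 2)).
    assert (E : (1 + rho' * transfer a b x ^ 2 - (1 + rho * transfer a b x ^ 2)) / ln 2
                <= (b + 2 * a) ^ 2 / ln 2 * (rho' - rho)).
    { replace ((b + 2 * a) ^ 2 / ln 2 * (rho' - rho))
        with ((b + 2 * a) ^ 2 * (rho' - rho) / ln 2) by (field; apply Rgt_not_eq, ln2_pos).
      apply Rmult_le_compat_r; [left; apply Rinv_0_lt_compat, ln2_pos | nra]. }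
    assert (D' : log2 (1 + rho' * transfer a b x ^ 2) - log2 (1 + rho * transfer a b x ^ 2)
      <= (1 + rho' * transfer a b x ^ 2 - (1 + rho * transfer a b x ^ 2)) / ln 2)
      by (apply D; nra).
    lra.
Qed.

Lemma Rw_0 (a b : R) : Rw a b 0 = 0.
Proof.
  unfold Rw. rewrite (RInt_ext _ (fun _ => 0)).
  - rewrite RInt_const. apply Rmult_0_r.
  - intros x _. rewrite Rmult_0_l, Rplus_0_r. unfold log2. rewrite ln_1.
    unfold Rdiv. apply Rmult_0_l.
Qed.

Lemma Rw_ge_log2 (a b rho : R) : 0 <= a -> 0 <= b -> 0 <= rho ->
  log2 (1 + rho * (a + b) ^ 2) / 6 <= Rw a b rho.
Proof.
  intros Ha Hb Hr. apply RInt_01_ge_sixth.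
  - intros x. now apply continuous_Rw_integrand.
  - intros x. apply log2_nonneg. assert (H := pow2_ge_0 (transfer a b x)). nra.
  - intros x Hx. assert (H := transfer_sqr_ge a b x Ha Hb Hx).
    assert (H' := pow2_ge_0 (a + b)). apply log2_le; nra.
Qed.

(** * The water-filling power at a single frequency *)

Lemma wf_power_of_nonpos (a b nu f : R) : nu <= 0 -> wf_power a b nu f = 0.
Proof.
  intros Hn. unfold wf_power. destruct (Req_EM_T _ 0) as [e | e]; [reflexivity |].
  apply Rmax_right.
  assert (0 < 1 / transfer a b f ^ 2); [| lra].
  apply Rdiv_lt_0_compat; [lra |]. now apply pow2_gt_0.
Qed.

(** This form has no case split at the zeros of [transfer]: wherever [H^2 <= / nu] it gives
    [nu - nu = 0]. The inverted quantity stays at least [/ nu], which makes continuity in [f]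
    accessible. *)
Lemma wf_power_of_pos (a b nu f : R) : 0 < nu ->
  wf_power a b nu f = nu - / Rmax (transfer a b f ^ 2) (/ nu).
Proof.
  intros Hn. assert (Hi := Rinv_0_lt_compat _ Hn).
  unfold wf_power. destruct (Req_EM_T _ 0) as [e | e].
  - rewrite e, Rmax_right by (simpl; lra). rewrite Rinv_inv. ring.
  - assert (Ht := pow2_gt_0 _ e).
    set (t := transfer a b f ^ 2) in *. unfold Rdiv. rewrite Rmult_1_l.
    destruct (Rle_dec t (/ nu)) as [h | h].
    + rewrite (Rmax_right t) by exact h. rewrite Rinv_inv.
      apply Rinv_le_contravar in h; [| exact Ht]. rewrite Rinv_inv in h.
      rewrite Rmax_right; lra.
    + rewrite (Rmax_left t (/ nu)) by lra.
      assert (h' : / t <= / / nu) by (apply Rinv_le_contravar; lra).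
      rewrite Rinv_inv in h'. rewrite Rmax_left; lra.
Qed.

Lemma continuous_wf_power (a b nu f : R) : continuous (wf_power a b nu) f.
Proof.
  destruct (Rle_dec nu 0) as [Hn | Hn].
  - apply (continuous_ext (fun _ => 0)).
    + intros x. now rewrite wf_power_of_nonpos.
    + apply continuous_const.
  - assert (Hp : 0 < nu) by lra. assert (Hi := Rinv_0_lt_compat _ Hp).
    (* The maximum is written as [(u + v + |u - v|) / 2], reducing its continuity to that of
       [Rabs]. *)
    apply (continuous_ext
      (fun x => nu - / ((transfer a b x ^ 2 + / nu + Rabs (transfer a b x ^ 2 - / nu)) / 2))).
    + intros x. rewrite wf_power_of_pos by exact Hp. do 2 f_equal.
      unfold Rmax, Rabs. destruct (Rle_dec _ _), (Rcase_abs _); lra.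
    + assert (Hc := continuous_transfer_sqr a b f).
      apply (continuous_minus (V := R_NormedModule)); [apply continuous_const |].
      apply (continuous_comp
        (fun x => (transfer a b x ^ 2 + / nu + Rabs (transfer a b x ^ 2 - / nu)) / 2) Rinv).
      * apply (continuous_mult (K := R_AbsRing)); [| apply continuous_const].
        apply (continuous_plus (V := R_NormedModule)).
        -- apply (continuous_plus (V := R_NormedModule)); [exact Hc | apply continuous_const].
        -- apply (continuous_comp (fun x => transfer a b x ^ 2 - / nu) Rabs);
             [| apply continuous_Rabs].
           apply (continuous_minus (V := R_NormedModule)); [exact Hc | apply continuous_const].
      * apply continuous_Rinv.
        assert (H1 := pow2_ge_0 (transfer a b f)).
        assert (H2 := Rabs_pos (transfer a b f ^ 2 - / nu)). lra.
Qed.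

Lemma wf_power_nonneg (a b nu f : R) : 0 <= wf_power a b nu f.
Proof.
  unfold wf_power. destruct (Req_EM_T _ 0); [lra | apply Rmax_r].
Qed.

Lemma wf_power_le (a b nu nu' f : R) : nu <= nu' ->
  wf_power a b nu f <= wf_power a b nu' f.
Proof.
  intros H. unfold wf_power. destruct (Req_EM_T _ 0); [lra |].
  apply Rle_max_compat_r. lra.
Qed.

Lemma wf_power_le_add (a b nu nu' f : R) : nu <= nu' ->
  wf_power a b nu' f <= wf_power a b nu f + (nu' - nu).
Proof.
  intros H. unfold wf_power. destruct (Req_EM_T _ 0); [lra |].
  unfold Rmax. destruct (Rle_dec _ _), (Rle_dec _ _); lra.
Qed.

(** With [k = nu' / nu >= 1] and [s = 1 / H^2], [k * (nu - s) = nu' - k * s <= nu' - s]. Integrated,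
    this makes the total power strictly increasing wherever it is positive, which monotonicity at
    each [f] alone does not give. *)
Lemma wf_power_scal_le (a b nu nu' f : R) : 0 < nu -> nu <= nu' ->
  nu' / nu * wf_power a b nu f <= wf_power a b nu' f.
Proof.
  intros Hn H. assert (Hk : 1 <= nu' / nu) by (apply Rle_div_r; lra).
  unfold wf_power. destruct (Req_EM_T _ 0) as [e | e]; [lra |].
  assert (Ht : 0 < 1 / transfer a b f ^ 2)
    by (apply Rdiv_lt_0_compat; [lra | now apply pow2_gt_0]).
  set (s := 1 / transfer a b f ^ 2) in *.
  assert (E : nu' = nu' / nu * nu) by (field; lra).
  set (k := nu' / nu) in *.
  destruct (Rle_dec (nu - s) 0) as [h | h].
  - rewrite (Rmax_right (nu - s)), Rmult_0_r by exact h. apply Rmax_r.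
  - rewrite (Rmax_left (nu - s) 0) by lra. eapply Rle_trans; [| apply Rmax_l]. nra.
Qed.

(** * The total power, the water level and the rate [Rwf] *)

Lemma total_power_le (a b nu : R) : 0 <= nu -> RInt (wf_power a b nu) 0 1 <= nu.
Proof.
  intros Hn.
  assert (E : RInt (fun _ : R => 0) 0 1 = 0) by (rewrite RInt_const; apply Rmult_0_r).
  replace nu with (RInt (fun _ : R => 0) 0 1 + nu) at 2 by (rewrite E; ring).
  apply RInt_01_le_add.
  - intros; apply continuous_wf_power.
  - intros; apply continuous_const.
  - intros x. assert (H := wf_power_le_add a b 0 nu x Hn).
    rewrite (wf_power_of_nonpos a b 0) in H; lra.
Qed.

Lemma continuity_total_power (a b : R) : continuity (fun nu => RInt (wf_power a b nu) 0 1).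
Proof.
  apply (lipschitz_continuity _ 1); [lra |]. intros x y Hxy.
  assert (H1 : RInt (wf_power a b x) 0 1 <= RInt (wf_power a b y) 0 1 + 0).
  { apply RInt_01_le_add; try (intros; apply continuous_wf_power).
    intros f. assert (H := wf_power_le a b x y f Hxy). lra. }
  assert (H2 : RInt (wf_power a b y) 0 1 <= RInt (wf_power a b x) 0 1 + (y - x)).
  { apply RInt_01_le_add; try (intros; apply continuous_wf_power).
    intros f. now apply wf_power_le_add. }
  apply Rabs_le. lra.
Qed.

Lemma total_power_ge (a b nu : R) : 0 <= a -> 0 <= b -> 0 < a + b ->
  (nu - / (a + b) ^ 2) / 6 <= RInt (wf_power a b nu) 0 1.
Proof.
  intros Ha Hb Hab. apply RInt_01_ge_sixth.
  - intros; apply continuous_wf_power.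
  - intros; apply wf_power_nonneg.
  - intros x Hx. assert (H := transfer_sqr_ge a b x Ha Hb Hx).
    assert (H' : 0 < (a + b) ^ 2) by (apply pow_lt; lra).
    unfold wf_power. destruct (Req_EM_T _ 0) as [e | e].
    (* [H = 0] is impossible on [0, 1/6], since [H^2 >= (a + b)^2 > 0] there. *)
    + rewrite e in H. simpl in H, H'. lra.
    + eapply Rle_trans; [| apply Rmax_l].
      apply Rinv_le_contravar in H; [| exact H']. unfold Rdiv. lra.
Qed.

Lemma water_level_exists_unique (a b rho : R) :
  0 <= a -> 0 <= b -> 0 < a + b -> 0 < rho -> exists! nu, is_water_level a b rho nu.
Proof.
  intros Ha Hb Hab Hr.
  assert (Hpos : forall nu, RInt (wf_power a b nu) 0 1 = rho -> 0 < nu).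
  { intros nu E. apply Rnot_le_lt. intros Hn.
    rewrite (RInt_ext _ (fun _ => 0)) in E.
    - rewrite RInt_const in E. unfold scal in E; simpl in E. unfold mult in E; simpl in E. lra.
    - intros x _. now apply wf_power_of_nonpos. }
  (* Two levels [x < y] of the same power would give [y / x * rho <= rho] with [y / x > 1]. *)
  assert (Hinj : forall x y, RInt (wf_power a b x) 0 1 = rho ->
                   RInt (wf_power a b y) 0 1 = rho -> x < y -> False).
  { intros x y Ex Ey Hxy. assert (Hx := Hpos x Ex).
    assert (S : y / x * RInt (wf_power a b x) 0 1 <= RInt (wf_power a b y) 0 1).
    { apply RInt_01_le_scal; try (intros; apply continuous_wf_power).
      intros f. apply wf_power_scal_le; lra. }
    rewrite Ex, Ey in S.
    assert (1 < y / x) by (apply Rlt_div_r; lra). nra. }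
  (* Chosen so that the lower bound of [total_power_ge] at [B] is exactly [rho]. *)
  set (B := 6 * rho + / (a + b) ^ 2).
  assert (HB : rho <= RInt (wf_power a b B) 0 1).
  { assert (H := total_power_ge a b B Ha Hb Hab). unfold B in *. lra. }
  assert (H0 : RInt (wf_power a b 0) 0 1 <= 0) by (apply total_power_le; lra).
  destruct (IVT_gen (fun nu => RInt (wf_power a b nu) 0 1) 0 B rho) as [nu [_ E]].
  - apply continuity_total_power.
  - rewrite Rmin_left, Rmax_right; lra.
  - exists nu. split.
    + split; [now apply Hpos | exact E].
    + intros y [_ Ey]. destruct (Rtotal_order nu y) as [h | [h | h]]; auto;
        exfalso; eauto.
Qed.

Lemma water_level_spec (a b rho : R) :
  0 <= a -> 0 <= b -> 0 < a + b -> 0 < rho -> is_water_level a b rho (water_level a b rho).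
Proof.
  intros Ha Hb Hab Hr. unfold water_level. apply epsilon_spec.
  destruct (water_level_exists_unique a b rho Ha Hb Hab Hr) as [nu [H _]]. now exists nu.
Qed.

(** On [0, 1/6] the argument of the logarithm is at least [1 + (nu - 1 / H^2) * H^2 = nu * H^2],
    where [nu >= rho] and [H^2 >= (a + b)^2]. *)
Lemma Rwf_ge_log2 (a b rho : R) : 0 <= a -> 0 <= b -> 0 < a + b -> 0 < rho ->
  log2 (rho * (a + b) ^ 2) / 6 <= Rwf a b rho.
Proof.
  intros Ha Hb Hab Hr.
  destruct (water_level_spec a b rho Ha Hb Hab Hr) as [Hn E].
  unfold Rwf. set (nu := water_level a b rho) in *.
  assert (Hrn : rho <= nu) by (rewrite <- E; apply total_power_le; lra).
  assert (P : forall x, 0 <= wf_power a b nu x * transfer a b x ^ 2)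
    by (intros x; apply Rmult_le_pos; [apply wf_power_nonneg | apply pow2_ge_0]).
  apply RInt_01_ge_sixth.
  - intros x. apply (continuous_rate (wf_power a b nu) (fun x => transfer a b x ^ 2)).
    + exact P.
    + apply continuous_wf_power.
    + apply continuous_transfer_sqr.
  - intros x. apply log2_nonneg. specialize (P x). lra.
  - intros x Hx. assert (H := transfer_sqr_ge a b x Ha Hb Hx).
    assert (H' : 0 < (a + b) ^ 2) by (apply pow_lt; lra).
    apply log2_le; [now apply Rmult_lt_0_compat |].
    assert (W : nu - / transfer a b x ^ 2 <= wf_power a b nu x).
    { unfold wf_power. destruct (Req_EM_T _ 0) as [e | e].
      - rewrite e in H. simpl in H, H'. lra.
      - unfold Rdiv. rewrite Rmult_1_l. apply Rmax_l. }
    set (t := transfer a b x ^ 2) in *.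
    assert (I : / t * t = 1) by (field; lra).
    nra.
Qed.

(** * Existence and uniqueness of [r*] *)

Lemma Rpower_2_opp_bounds (r : R) : 0 <= r -> 0 < Rpower 2 (- r) <= 1.
Proof.
  intros Hr. split; [apply exp_pos |].
  rewrite <- (Rpower_O 2) by lra. apply Rle_Rpower; lra.
Qed.

(** The equation is rearranged as [F r = T], where [T] is the rate of the second hop, and solved on
    [0, T]. *)
Lemma rstar_exists_unique (alpha beta eta gamma rho1 rho2 : R) :
  0 <= alpha -> 0 <= beta -> 0 <= rho1 -> 0 <= rho2 ->
  exists! r, is_rstar alpha beta eta gamma rho1 rho2 r.
Proof.
  intros Ha Hb H1 H2.
  set (T := Rw eta gamma rho2).
  assert (HT : 0 <= T) by now apply Rw_nonneg.
  set (G := fun rho => Rw alpha beta (Rmax rho 0)).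
  (* [Rmax _ 0] extends the equation to all real [r], as [IVT_gen] requires. *)
  set (F := fun r => G (rho1 * (1 - Rpower 2 (- r))) + r).
  assert (HF : forall r, 0 <= r -> F r = Rw alpha beta (rho1 * (1 - Rpower 2 (- r))) + r).
  { intros r Hr. unfold F, G. rewrite Rmax_left; [reflexivity |].
    assert (H := Rpower_2_opp_bounds r Hr). nra. }
  assert (HGc : continuity G).
  { apply (lipschitz_continuity _ ((beta + 2 * alpha) ^ 2 / ln 2)).
    - apply Rmult_le_pos; [apply pow2_ge_0 | left; apply Rinv_0_lt_compat, ln2_pos].
    - intros x y Hxy. unfold G.
      assert (Hm : Rmax x 0 <= Rmax y 0) by now apply Rle_max_compat_r.
      assert (Hd : Rmax y 0 - Rmax x 0 <= y - x)
        by (unfold Rmax; destruct (Rle_dec _ _), (Rle_dec _ _); lra).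
      assert (Hle := Rw_le alpha beta _ _ (Rmax_r x 0) Hm).
      assert (Hli := Rw_lipschitz alpha beta _ _ Ha Hb (Rmax_r x 0) Hm).
      assert (HL : 0 <= (beta + 2 * alpha) ^ 2 / ln 2)
        by (apply Rmult_le_pos; [apply pow2_ge_0 | left; apply Rinv_0_lt_compat, ln2_pos]).
      apply Rabs_le. nra. }
  assert (HFc : continuity F).
  { intros r. apply continuity_pt_filterlim.
    apply (continuous_plus (V := R_NormedModule)); [| apply continuous_id].
    apply (continuous_comp (fun r => rho1 * (1 - Rpower 2 (- r))) G).
    - apply (ex_derive_continuous (V := R_NormedModule)). unfold Rpower.
      auto_derive. exact I.
    - apply continuity_pt_filterlim, HGc. }
  (* Strictness comes from the summand [r] alone; the rate term is only known to be
     nondecreasing. *)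
  assert (Hinc : forall x y, 0 <= x -> x < y -> F x < F y).
  { intros x y Hx Hxy. rewrite !HF by lra.
    assert (Hp : Rpower 2 (- y) <= Rpower 2 (- x)) by (apply Rle_Rpower; lra).
    assert (Hq := Rpower_2_opp_bounds x Hx).
    assert (Rw alpha beta (rho1 * (1 - Rpower 2 (- x)))
            <= Rw alpha beta (rho1 * (1 - Rpower 2 (- y)))); [| lra].
    apply Rw_le; nra. }
  assert (F0 : F 0 = 0).
  { rewrite HF by lra. rewrite Ropp_0, Rpower_O by lra.
    rewrite Rminus_diag, Rmult_0_r, Rw_0. ring. }
  assert (FT : T <= F T).
  { rewrite HF by exact HT.
    assert (0 <= Rw alpha beta (rho1 * (1 - Rpower 2 (- T)))); [| lra].
    apply Rw_nonneg. assert (H := Rpower_2_opp_bounds T HT). nra. }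
  destruct (IVT_gen F 0 T T HFc) as [r [Hr E]].
  - rewrite F0, Rmin_left, Rmax_right; lra.
  - rewrite Rmin_left, Rmax_right in Hr by lra. exists r. split.
    + split; [lra |]. rewrite HF in E by lra. fold T. lra.
    + intros y [Hy Ey]. fold T in Ey. assert (Fy : F y = T) by (rewrite HF; lra).
      destruct (Rtotal_order r y) as [h | [h | h]]; auto; exfalso.
      * assert (H := Hinc r y (proj1 Hr) h). lra.
      * assert (H := Hinc y r Hy h). lra.
Qed.

Lemma rstar_spec (alpha beta eta gamma rho1 rho2 : R) :
  0 <= alpha -> 0 <= beta -> 0 <= rho1 -> 0 <= rho2 ->
  is_rstar alpha beta eta gamma rho1 rho2 (rstar alpha beta eta gamma rho1 rho2).
Proof.
  intros Ha Hb H1 H2. unfold rstar. apply epsilon_spec.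
  destruct (rstar_exists_unique alpha beta eta gamma rho1 rho2 Ha Hb H1 H2) as [r [H _]].
  now exists r.
Qed.

(** * Limits as [rho2] tends to infinity *)

Lemma log2_scal_unbounded (c K : R) : 0 < c ->
  exists M, 0 < M /\ forall rho, M < rho -> K < log2 (rho * c).
Proof.
  intros Hc. assert (Hp : 0 < Rpower 2 (K + 1)) by apply exp_pos.
  (* The extra 1 yields a strict bound from the non-strict [log2_le]. *)
  exists (Rpower 2 (K + 1) / c). split; [now apply Rdiv_lt_0_compat |].
  intros rho Hr. apply Rlt_div_l in Hr; [| exact Hc].
  assert (H : log2 (Rpower 2 (K + 1)) <= log2 (rho * c)) by (apply log2_le; lra).
  rewrite log2_Rpower in H. lra.
Qed.

(** By its equation [r*] is at least [Rw eta gamma rho2 - Rw alpha beta rho1], whose first term is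
    unbounded. *)
Lemma rstar_lim (alpha beta eta gamma rho1 : R) :
  0 <= alpha -> 0 <= beta -> 0 <= eta -> 0 <= gamma -> 0 < eta + gamma -> 0 <= rho1 ->
  is_lim (fun rho2 => rstar alpha beta eta gamma rho1 rho2) p_infty p_infty.
Proof.
  intros Ha Hb He Hg Heg H1. apply is_lim_spec. intros K.
  assert (Hc : 0 < (eta + gamma) ^ 2) by now apply pow_lt.
  (* The factor 6 cancels the 1/6 in [Rw_ge_log2]. *)
  destruct (log2_scal_unbounded _ (6 * (K + Rw alpha beta rho1)) Hc) as [M [HM H]].
  exists M. intros rho2 Hr. specialize (H rho2 Hr).
  destruct (rstar_spec alpha beta eta gamma rho1 rho2) as [Hr0 E]; try lra.
  set (r := rstar alpha beta eta gamma rho1 rho2) in *.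
  assert (Hq := Rpower_2_opp_bounds r Hr0).
  assert (Hle : Rw alpha beta (rho1 * (1 - Rpower 2 (- r))) <= Rw alpha beta rho1)
    by (apply Rw_le; nra).
  assert (Hge := Rw_ge_log2 eta gamma rho2 He Hg).
  assert (Hl : log2 (rho2 * (eta + gamma) ^ 2) <= log2 (1 + rho2 * (eta + gamma) ^ 2))
    by (apply log2_le; [apply Rmult_lt_0_compat |]; lra).
  lra.
Qed.

Lemma Rcf_lim (alpha beta eta gamma rho1 : R) :
  0 <= alpha -> 0 <= beta -> 0 <= eta -> 0 <= gamma -> 0 < eta + gamma -> 0 <= rho1 ->
  is_lim (fun rho2 => Rcf alpha beta eta gamma rho1 rho2) p_infty (Rw alpha beta rho1).
Proof.
  intros Ha Hb He Hg Heg H1.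
  set (L := (beta + 2 * alpha) ^ 2 / ln 2).
  assert (HL : 0 <= L)
    by (apply Rmult_le_pos; [apply pow2_ge_0 | left; apply Rinv_0_lt_compat, ln2_pos]).
  assert (Hlim := rstar_lim alpha beta eta gamma rho1 Ha Hb He Hg Heg H1).
  apply is_lim_spec in Hlim. apply is_lim_spec. intros eps.
  set (d := eps / (L * rho1 + 1)).
  assert (HLr : 0 <= L * rho1) by now apply Rmult_le_pos.
  assert (Heps := cond_pos eps).
  assert (Hd : 0 < d) by (apply Rdiv_lt_0_compat; lra).
  destruct (Hlim (- log2 d)) as [M H].
  (* The maximum with 0 makes [rho2] positive, so that [rstar_spec] applies. *)
  exists (Rmax M 0). intros rho2 Hr.
  assert (HrM : M < rho2) by (eapply Rle_lt_trans; [apply Rmax_l | exact Hr]).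
  assert (Hr2 : 0 < rho2) by (eapply Rle_lt_trans; [apply Rmax_r | exact Hr]).
  specialize (H rho2 HrM).
  destruct (rstar_spec alpha beta eta gamma rho1 rho2) as [Hr0 _]; try lra.
  unfold Rcf. set (r := rstar alpha beta eta gamma rho1 rho2) in *.
  assert (Hq := Rpower_2_opp_bounds r Hr0).
  assert (Hdq : Rpower 2 (- r) <= d).
  { replace d with (Rpower 2 (log2 d)).
    - apply Rle_Rpower; lra.
    - unfold Rpower, log2. replace (ln d / ln 2 * ln 2) with (ln d).
      + now apply exp_ln.
      + field. apply Rgt_not_eq, ln2_pos. }
  set (q := Rpower 2 (- r)) in *.
  assert (Hle : Rw alpha beta (rho1 * (1 - q)) <= Rw alpha beta rho1) by (apply Rw_le; nra).
  assert (Hli : Rw alpha beta rho1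
                <= Rw alpha beta (rho1 * (1 - q)) + L * (rho1 - rho1 * (1 - q)))
    by (apply Rw_lipschitz; nra).
  assert (Hb1 : L * (rho1 - rho1 * (1 - q)) <= L * rho1 * d)
    by (replace (L * (rho1 - rho1 * (1 - q))) with (L * rho1 * q) by ring;
        now apply Rmult_le_compat_l).
  assert (Hb2 : (L * rho1 + 1) * d = eps) by (unfold d; field; lra).
  apply Rabs_lt_between. lra.
Qed.

Lemma Rub_lim (alpha beta eta gamma rho1 : R) :
  0 <= eta -> 0 <= gamma -> 0 < eta + gamma ->
  is_lim (fun rho2 => Rub alpha beta eta gamma rho1 rho2) p_infty (Rw alpha beta rho1).
Proof.
  intros He Hg Heg.
  apply (is_lim_ext_loc (fun _ => Rw alpha beta rho1)); [| apply is_lim_const].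
  assert (Hc : 0 < (eta + gamma) ^ 2) by now apply pow_lt.
  (* Beyond [M], [Rwf] exceeds [Rw alpha beta rho1], so [Rub] is constant there. *)
  destruct (log2_scal_unbounded _ (6 * Rw alpha beta rho1) Hc) as [M [HM H]].
  exists M. intros rho2 Hr. specialize (H rho2 Hr).
  assert (Hge := Rwf_ge_log2 eta gamma rho2 He Hg Heg).
  unfold Rub. rewrite Rmin_left; [reflexivity |]. lra.
Qed.

(** The two uniqueness claims ensure that the values picked by [epsilon] in [water_level] and
    [rstar] are the intended ones, so the limits concern the intended quantities. *)
Theorem mainTheorem2 (alpha beta eta gamma rho1 : R)
  (halpha : 0 <= alpha) (hbeta : 0 <= beta)
  (heta : 0 <= eta) (hgamma : 0 <= gamma)
  (hne : (eta, gamma) <> (0, 0)) (hrho1 : 0 < rho1) :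
  (forall rho2 : R, 0 < rho2 ->
     exists! nu : R, is_water_level eta gamma rho2 nu) /\
  (forall rho2 : R, 0 < rho2 ->
     exists! r : R, is_rstar alpha beta eta gamma rho1 rho2 r) /\
  is_lim (fun rho2 => rstar alpha beta eta gamma rho1 rho2) p_infty p_infty /\
  is_lim (fun rho2 => Rcf alpha beta eta gamma rho1 rho2) p_infty
         (Finite (Rw alpha beta rho1)) /\
  is_lim (fun rho2 => Rub alpha beta eta gamma rho1 rho2) p_infty
         (Finite (Rw alpha beta rho1)).
Proof.
  assert (Heg : 0 < eta + gamma).
  { destruct (Req_dec eta 0) as [e | e]; [| lra].
    destruct (Req_dec gamma 0) as [g | g]; [| lra].
    subst. now contradiction hne. }
  repeat split.
  - intros rho2 H. now apply water_level_exists_unique.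
  - intros rho2 H. apply rstar_exists_unique; lra.
  - apply rstar_lim; lra.
  - apply Rcf_lim; lra.
  - now apply Rub_lim.
Qed.
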